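(* Let $k\ge 2$, $m\ge 1$, $t\ge 1$ be integers, let $f_1,\dots,f_m\in\mathbb{R}[X]$ be non-zero $t$-sparse polynomials, and let $\alpha_{ij}$ ($1\le i\le k$, $1\le j\le m$) be non-negative integers. Let \[\phi(X)=\sum_{i=1}^k\prod_{j=1}^m f_j^{\alpha_{ij}}(X),\] and assume $\phi$ is not identically zero. Then $\phi$ has at most \[C\times\left[e\times\left(1+\frac{t^m}{2^{k-1}-1}\right)\right]^{2^{k-1}-1}\] distinct real roots, where $C$ is a universal constant.
   Context: A polynomial is $t$-sparse if it has at most $t$ monomials (non-zero terms). $e$ is Euler's number. *)

(* Defs.v *)
From mathcomp Require Import all_boot all_order all_algebra.
From mathcomp Require Import reals.
Set Implicit Arguments.
Unset Strict Implicit.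
Unset Printing Implicit Defensive.
Import GRing.Theory.
Local Open Scope ring_scope.

Definition sparse (R : realType) (t : nat) (p : {poly R}) : Prop :=
  (count (fun c : R => c != 0%R) p <= t)%N.

Definition sum_of_powers (R : realType) (k m : nat)
    (f : 'I_m -> {poly R}) (alpha : 'I_k -> 'I_m -> nat) : {poly R} :=
  \sum_(i < k) \prod_(j < m) f j ^+ alpha i j.

(* Main.v *)
(** Roots are counted by iterated Rolle on the positive half-line; substituting
    [- 'X] for ['X] takes care of the negative ones.  Write
    [euler p = 'X * p^`()], which does not enlarge supports,
    [F i = \prod_j f j ^+ alpha i j] and [pi = \prod_j f j].  Dividing a sum
    [\sum_i g i * F i] by [g i0 * F i0] and applying [euler] kills the [i0]-th
    term; up to factors vanishing only where [pi] or [g i0] does, what remains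
    is again a sum [\sum_i h i * F i] with the same [F i].  Let [S] be the
    sumset of the supports of the [f j], of size at most [N = t ^ m].  If the
    [g i] are supported in the [n]-fold sumset of [S], then the [h i] are
    supported in the [(2n+1)]-fold one; starting from constants, the [i]-th step
    has [n = 2 ^ i - 1].  A nonzero polynomial supported in the [n]-fold sumset
    has fewer than ['C(N + n - 1, n)] positive roots, and by Pascal's rule these
    bounds add up to at most ['C(N + n, n)] with [n = 2 ^ (k - 1) - 1], which is
    at most [(e (1 + N / n)) ^ n]. *)
Require Import Defs.
From mathcomp Require Import all_boot all_order all_algebra.
From mathcomp Require Import polyrcf ring zify.
From mathcomp Require Import functions.
From mathcomp Require Import reals normedtype derive realfun sequences exp.
Set Implicit Arguments.
Unset Strict Implicit.
Unset Printing Implicit Defensive.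
Import Order.TTheory GRing.Theory Num.Theory.
Import numFieldNormedType.Exports.
Local Open Scope ring_scope.

(** * Iterated sumsets and binomial estimates *)

Section Sumsets.
Local Open Scope nat_scope.
Implicit Types (S T : seq nat).

(* One entry for each multiset of [n] elements of [S]. *)
Fixpoint nsums S : nat -> seq nat :=
  if S is s :: S' then
    fix nsums_s n :=
      if n is n'.+1 then [seq s + x | x <- nsums_s n'] ++ nsums S' n'.+1
      else [:: 0]
  else fun n => if n is 0 then [:: 0] else [::].

Lemma nsums0 S : nsums S 0 = [:: 0].
Proof. by case: S. Qed.

(** Splitting multisets by whether they use the head of [S] is Pascal's rule; the truncated
    predecessor is also right for empty [S]. *)
Lemma size_nsums S n : size (nsums S n) = 'C((size S + n).-1, n).
Proof.
elim: S n => [|s S IHS] n; first by case: n => //= n; rewrite bin_small.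
elim: n => [|n IHn]; first by rewrite bin0.
by rewrite [nsums _ _]/= size_cat size_map [size _]IHn IHS !addnS /= binS addnC.
Qed.

Lemma nsumsP S n x :
  reflect (exists u, [/\ size u = n, {subset u <= S} & x = sumn u])
          (x \in nsums S n).
Proof.
apply: (iffP idP) => [|[u [<- uS ->]]]; last first.
  elim: S u uS => [|s S IHS] u.
    by case: u => [|y u] uS //; have := uS y (mem_head _ _).
  have [k] := ubnP (size u); elim: k u => // k IHk u uk uS.
  case: u uk uS => [|y u] uk uS; first by rewrite inE.
  rewrite [nsums _ _]/= mem_cat.
  have [su|su] := boolP (s \in y :: u); last first.
    apply/orP; right; apply: (IHS (y :: u)) => z zu.
    have := uS z zu; rewrite inE => /predU1P[zs|//].
    by rewrite -zs zu in su.
  apply/orP; left; have pu := perm_to_rem su.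
  have szr : size (rem s (y :: u)) = size u by rewrite size_rem.
  rewrite (perm_sumn pu) [sumn _]/=; apply: map_f.
  rewrite -szr; apply: IHk; first by rewrite szr.
  by move=> z zr; apply: uS; exact: (@mem_rem _ s (y :: u) z zr).
elim: S n x => [|s S IHS] n x.
  by case: n => //; rewrite inE => /eqP->; exists [::].
elim: n x => [|n IHn] x; first by rewrite inE => /eqP->; exists [::].
rewrite [nsums _ _]/= mem_cat => /orP[/mapP[y /IHn[u [su uS ->]] ->]|/IHS].
  exists (s :: u); split=> //=; first by rewrite su.
  by move=> z; rewrite inE => /predU1P[->|/uS//]; rewrite mem_head.
by move=> [u [su uS ->]]; exists u; split=> // z /uS; rewrite inE orbC => ->.
Qed.

Lemma nsumsD S m n x y : x \in nsums S m -> y \in nsums S n ->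
  x + y \in nsums S (m + n).
Proof.
move=> /nsumsP[u [<- uS ->]] /nsumsP[v [<- vS ->]].
apply/nsumsP; exists (u ++ v); rewrite size_cat sumn_cat; split=> // z.
by rewrite mem_cat => /orP[/uS|/vS].
Qed.

Lemma mem_nsums1 S x : x \in S -> x \in nsums S 1.
Proof.
move=> xS; apply/nsumsP; exists [:: x]; rewrite /= addn0; split=> // z.
by rewrite inE => /eqP->.
Qed.

Definition sumset (I : Type) (L : I -> seq nat) (r : seq I) : seq nat :=
  foldr (fun j T => [seq x + y | x <- L j, y <- T]) [:: 0] r.

Lemma size_sumset (I : Type) (L : I -> seq nat) (r : seq I) t :
  (forall j, size (L j) <= t) -> size (sumset L r) <= t ^ size r.
Proof.
move=> Lt; elim: r => //= j r IHr.
by rewrite size_allpairs expnS leq_mul.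
Qed.

Lemma bin_addn_leq N m n : m <= n -> 'C(N + m, m) <= 'C(N + n, n).
Proof.
move=> /subnKC <-; elim: (n - m) => [|k IHk]; first by rewrite addn0.
by rewrite addnS (leq_trans IHk) // addnS binS leq_addl.
Qed.

(** Pascal's rule splits the right-hand side at [k.+1] into the new summand and a binomial with
    lower index [2 ^ k.+1 - 2], which dominates the bound for [k]. *)
Lemma sum_multichoose_dyadic N k :
  \sum_(i < k.+1) 'C((N + (2 ^ i - 1)).-1, 2 ^ i - 1) <=
  'C(N + (2 ^ k - 1), 2 ^ k - 1).
Proof.
elim: k => [|k IHk]; first by rewrite big_ord_recl big_ord0 !bin0.
rewrite big_ord_recr /=.
have k0 : 0 < 2 ^ k by rewrite expn_gt0.
have -> : 2 ^ k.+1 - 1 = (2 ^ k.+1 - 2).+1 by rewrite expnS; lia.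
rewrite addnS /= binS addnC leq_add2l (leq_trans IHk) // bin_addn_leq //.
by rewrite expnS; lia.
Qed.

(** Each Pascal step along the diagonal adds at least [N]. This later absorbs the terms linear in
    [N]. *)
Lemma muln_lt_bin N n : n * N < 'C(N + n, n).
Proof.
have H j : N <= 'C(N + j, j.+1).
  elim: j => [|j IHj]; first by rewrite addn0 bin1.
  by rewrite addnS binS (leq_trans IHj) // leq_addl.
elim: n => [|n IHn]; first by rewrite bin0.
by rewrite mulSn addnS binS -addnS leq_add.
Qed.

Lemma ffact_leq_exp n m : n ^_ m <= n ^ m.
Proof.
elim: m n => [|m IHm] n; first by rewrite ffactn0.
by rewrite ffactnSr expnSr leq_mul // leq_subr.
Qed.

End Sumsets.

(** * Rolle's theorem and counting of distinct roots *)

Section RealRoots.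
Variable R : realType.
Implicit Types (p q d r : {poly R}) (P Q : pred R) (s : seq R)
  (L S T : seq nat).

Lemma rolle_quotient p q (a b : R) : a < b ->
  (forall x, a <= x <= b -> q.[x] != 0) -> root p a -> root p b ->
  exists2 c, a < c < b & root (p^`() * q - p * q^`()) c.
Proof.
move=> ab q0 /rootP pa /rootP pb.
pose f : R -> R := horner p * (fun x => q.[x]^-1).
have df x : a <= x <= b ->
    is_derive x 1 f ((p^`().[x] * q.[x] - p.[x] * q^`().[x]) / q.[x] ^+ 2).
  move=> /q0 qx.
  have dq := is_deriveV qx (is_derive_poly q x).
  have dp := is_derive_poly p x.
  apply: is_derive_eq (is_deriveM dp dq) _.
  by rewrite /= /GRing.scale /=; field.
have [|||c] := @Rolle R f a b ab.
- move=> x; rewrite in_itv /= => /andP[/ltW ax /ltW xb].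
  by have [] := df x; rewrite ?ax ?xb.
- by apply: derivable_within_continuous => x; rewrite in_itv /= => /df [].
- by rewrite /f !fctE pa pb !mul0r.
rewrite in_itv /= => cab [_ fc]; exists c => //.
have cab' : a <= c <= b by case/andP: cab => /ltW-> /ltW->.
have [_ fc'] := df c cab'.
move: fc; rewrite fc' => /eqP.
rewrite mulf_eq0 invr_eq0 expf_eq0 /= (negbTE (q0 _ cab')) orbF.
by rewrite /root !hornerE.
Qed.

(** The witness in the first gap is lost on restricting [s'] to points beyond [y]. No order on [s']
    is assumed, so it can be a concatenation of root lists. *)
Lemma size_interleaved s s' : sorted <%R s ->
  {in s &, forall x y, x < y -> exists2 c, c \in s' & x < c < y} ->
  (size s <= (size s').+1)%N.
Proof.
elim: s s' => [|x [|y s] IHs] // s' /= /andP[xy ys] H.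
have sub : {subset y :: s <= [:: x, y & s]} by move=> z zs; rewrite inE zs orbT.
have [c cs' /andP[xc cy]] := H x y (mem_head _ _) (sub _ (mem_head _ _)) xy.
have := IHs [seq z <- s' | y < z] ys; rewrite size_filter => IH.
apply: leq_ltn_trans (IH _) _.
  move=> u v uys vys uv.
  have [z zs' /andP[uz zv]] := H u v (sub _ uys) (sub _ vys) uv.
  exists z; last by rewrite uz.
  rewrite mem_filter zs' andbT (le_lt_trans _ uz) //.
  move: uys; rewrite inE => /predU1P[->//|us].
  by have /allP/(_ _ us)/ltW := order_path_min lt_trans ys.
rewrite ltnS -(count_predC (fun z => y < z) s') -addn1 leq_add2l -has_count.
by apply/hasP; exists c => //=; rewrite -leNgt ltW.
Qed.

(** The zero polynomial counts as having no roots, since [rootsR 0] is empty. *)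
Definition nroots P p := count P (rootsR p).

Lemma nroots_filterE P p : nroots P p = size ([seq x <- rootsR p | P x]).
Proof. by rewrite size_filter. Qed.

Lemma mem_rootsR p x : p != 0 -> (x \in rootsR p) = root p x.
Proof. by move=> /roots_on_rootsR/(_ x); rewrite in_itv. Qed.

Lemma uniq_rootsR p : uniq (rootsR p).
Proof. exact: uniq_roots. Qed.

Lemma size_le_nroots P p s : p != 0 -> uniq s ->
  {in s, forall x, P x && root p x} -> (size s <= nroots P p)%N.
Proof.
move=> p0 us H; rewrite nroots_filterE; apply: uniq_leq_size => // x xs.
by have /andP[Px rx] := H x xs; rewrite mem_filter Px mem_rootsR.
Qed.

Lemma nroots_le P Q p q : q != 0 ->
    (forall x, P x -> root p x -> Q x /\ root q x) ->
  (nroots P p <= nroots Q q)%N.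
Proof.
move=> q0 H; have [->|p0] := eqVneq p 0; first by rewrite /nroots rootsR0.
rewrite {1}nroots_filterE; apply: size_le_nroots => //.
  exact: filter_uniq (uniq_rootsR p).
by move=> x; rewrite mem_filter mem_rootsR // => /andP[Px /(H x Px)[-> ->]].
Qed.

Lemma nroots_le_add P Q1 Q2 p q1 q2 : q1 != 0 -> q2 != 0 ->
  (forall x, P x -> root p x -> (Q1 x && root q1 x) || (Q2 x && root q2 x)) ->
  (nroots P p <= nroots Q1 q1 + nroots Q2 q2)%N.
Proof.
move=> q10 q20 H; have [->|p0] := eqVneq p 0; first by rewrite /nroots rootsR0.
rewrite 3!nroots_filterE -size_cat; apply: uniq_leq_size.
  exact: filter_uniq (uniq_rootsR p).
move=> x; rewrite mem_cat !mem_filter !mem_rootsR // => /andP[Px rx].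
exact: H.
Qed.

(** * The Euler operator and Wronskians *)

Definition euler p := 'X * p^`().

Lemma eulerD p q : euler (p + q) = euler p + euler q.
Proof. by rewrite /euler derivD mulrDr. Qed.

Lemma eulerM p q : euler (p * q) = euler p * q + p * euler q.
Proof. by rewrite /euler derivM; ring. Qed.

Lemma coef_euler p i : (euler p)`_i = p`_i *+ i.
Proof.
by rewrite /euler coefXM; case: i => [|i]; rewrite ?mulr0n //= coef_deriv.
Qed.

(** This is ['X] times the numerator of the derivative of [p / q]; on the positive half-line the
    extra factor adds no zero. *)
Definition wronskian p q := euler p * q - p * euler q.

Definition positive : pred R := [pred x | 0 < x].

Definition pos_off d : pred R := [pred x | positive x && ~~ root d x].

(** Degenerate case of the Rolle step: a zero Wronskian means that [p] and [q] are proportional when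
    [q] is non-zero. *)
Lemma wronskian0_root p q x : p != 0 -> wronskian p q = 0 -> 0 < x ->
  root p x -> root q x.
Proof.
move=> p0 W0 x0 px.
have [m [s sx pE]] := multiplicity_XsubC p x.
have {}sx : ~~ root s x by rewrite p0 in sx.
case: m pE => [|m] pE; first by rewrite pE expr0 mulr1 (negbTE sx) in px.
have {}W0 : p^`() * q - p * q^`() = 0.
  apply/eqP; move/eqP: W0; rewrite /wronskian /euler.
  have -> : 'X * p^`() * q - p * ('X * q^`()) =
            'X * (p^`() * q - p * q^`()) by ring.
  by rewrite mulf_eq0 polyX_eq0.
(* Here [x] has multiplicity [m.+1] in [p]; without the factor [('X - x%:P) ^+ m], evaluation at [x]
   leaves [m.+1] times [s.[x] * q.[x]]. *)
have: ('X - x%:P) ^+ m *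
    (('X - x%:P) * (s^`() * q - s * q^`()) + s * q *+ m.+1) = 0.
  apply: etrans W0; rewrite pE derivM deriv_exp derivXsubC /= mul1r exprS.
  rewrite -(mulr_natr (s * q)) -(mulr_natr (_ ^+ m)).
  move: ('X - x%:P) (_ ^+ m) (m.+1%:R) s^`() q^`() => u um c s1 q1.
  by ring.
move/eqP; rewrite mulf_eq0 expf_eq0 polyXsubC_eq0 andbF /=.
move=> /eqP/(congr1 (horner^~ x)).
rewrite !(hornerE, hornerMn) subrr mul0r add0r => /eqP.
by rewrite -mulr_natr !mulf_eq0 pnatr_eq0 orbF -!/(root _ _) (negbTE sx).
Qed.

(* [a * wronskian p q = b * r] presents the derivative of [p / q] by a
   polynomial [r] with the same zeros away from those of [d]. *)
Lemma nroots_wronskian p q r d (a b : {poly R}) : p != 0 -> d != 0 -> r != 0 ->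
    a * wronskian p q = b * r ->
    (forall x, root q x -> root d x) -> (forall x, root b x -> root d x) ->
  (nroots (pos_off d) p <= (nroots positive d + nroots (pos_off d) r).+1)%N.
Proof.
move=> p0 d0 r0 E qd bd; rewrite 3!nroots_filterE -size_cat.
apply: size_interleaved.
  apply: sorted_filter; first exact: lt_trans.
  exact: sorted_roots.
move=> x y; rewrite !mem_filter !mem_rootsR //= => /andP[/andP[x0 dx] px].
move=> /andP[/andP[y0 dy] py] xy.
(* Either [d] vanishes inside the gap, or it has no zero on the closed interval and Rolle applies to
   [p / q]. *)
have [/hasP[c cd /= cxy]|/hasPn nd] :=
  boolP (has (fun c => x < c < y) (rootsR d)).
  exists c => //; rewrite mem_cat mem_filter cd /positive /= (lt_trans x0) //.
  by case/andP: cxy.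
have dxy z : x <= z <= y -> ~~ root d z.
  move=> /andP[]; rewrite le_eqVlt => /predU1P[<-//|xz].
  rewrite le_eqVlt => /predU1P[->//|zy]; apply/negP; rewrite -mem_rootsR //.
  by move/nd; rewrite xz zy.
have qxy z : x <= z <= y -> q.[z] != 0.
  by move=> /dxy; apply: contraNneq => qz; apply/qd/rootP.
have [c cxy Wc] := rolle_quotient xy qxy px py.
have dc : ~~ root d c by apply: dxy; case/andP: cxy => /ltW-> /ltW->.
have c0 : 0 < c by apply: lt_trans x0 _; case/andP: cxy.
exists c => //; rewrite mem_cat; apply/orP; right.
rewrite mem_filter mem_rootsR // /pos_off /positive /= c0 dc /=.
have : root (b * r) c.
  rewrite -E /wronskian /euler.
  have -> : a * ('X * p^`() * q - p * ('X * q^`())) =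
            a * 'X * (p^`() * q - p * q^`()) by ring.
  by rewrite rootM Wc orbT.
by rewrite rootM => /orP[/bd|//]; rewrite (negbTE dc).
Qed.

(** * Supports and the number of positive roots *)

Definition supported (L : seq nat) p := forall i, p`_i != 0 -> i \in L.

(* The map [p |-> euler p - p *+ d] removes the monomial ['X^d], so Rolle gives
   a weak Descartes bound. *)
Lemma nroots_supported p L : p != 0 -> supported L p ->
  (nroots positive p < size L)%N.
Proof.
elim: L p => [|d L IHL] p p0 pL.
  by case/eqP: p0; apply/polyP => i; rewrite coef0; apply/eqP/negP => /negP/pL.
pose p1 := euler p - p *+ d.
have eulerXd : euler 'X^d = 'X^d *+ d.
  rewrite /euler derivXn; case: (d) => [|n]; first by rewrite !mulr0n mulr0.
  by rewrite mulrnAr -exprS.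
have E : 1 * wronskian p 'X^d = 'X^d * p1.
  by rewrite /wronskian /p1 eulerXd -(mulr_natr p) -(mulr_natr 'X^d); ring.
have rX (x : R) : 0 < x -> ~~ root 'X^d x.
  by move=> x0; rewrite /root hornerXn expf_neq0 // gt_eqF.
(* If [p1] vanishes, [p] is a multiple of ['X^d] and has no positive root. *)
have [p10|p10] := eqVneq p1 0.
  suff -> : nroots positive p = 0%N by [].
  apply/eqP; rewrite /nroots eqn0Ngt -has_count; apply/hasPn => x.
  rewrite mem_rootsR //= => px; apply/negP => x0.
  have W0 : wronskian p 'X^d = 0 by rewrite -[LHS]mul1r E p10 mulr0.
  by have := wronskian0_root p0 W0 x0 px; rewrite (negbTE (rX _ x0)).
have p1L : supported L p1.
  move=> i; rewrite coefB coef_euler coefMn => ip1.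
  have := pL i; rewrite inE; case: (eqVneq i d) => [iE|_] /=.
    by rewrite iE subrr eqxx in ip1.
  by apply; apply: contraNneq ip1 => ->; rewrite !mul0rn subrr.
(* The exceptional polynomial is ['X], which excludes no positive point. *)
have Xd0 (x : R) : root 'X^d x -> root 'X x.
  by rewrite /root hornerXn hornerX expf_eq0 => /andP[].
have X0 : 'X != 0 :> {poly R} by rewrite polyX_eq0.
have := nroots_wronskian p0 X0 p10 E Xd0 Xd0.
have -> : nroots positive 'X = 0%N.
  apply/eqP; rewrite /nroots eqn0Ngt -has_count; apply/hasPn => x.
  rewrite mem_rootsR // /positive /= /root hornerX => /eqP->.
  by rewrite ltxx.
rewrite add0n => H; rewrite /= ltnS.
have pX : (nroots positive p <= nroots (pos_off 'X) p)%N.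
  apply: nroots_le => // x x0 px; split=> //.
  by rewrite /pos_off /= x0 /root hornerX gt_eqF.
apply: leq_trans pX (leq_trans H _); apply: leq_ltn_trans (IHL _ p10 p1L).
by apply: nroots_le => // x /andP[].
Qed.

Lemma supportedD L p q : supported L p -> supported L q -> supported L (p + q).
Proof.
move=> pL qL i; rewrite coefD.
by have [->|/pL//] := eqVneq p`_i 0; rewrite add0r => /qL.
Qed.

Lemma supportedN L p : supported L p -> supported L (- p).
Proof. by move=> pL i; rewrite coefN oppr_eq0 => /pL. Qed.

Lemma supportedB L p q : supported L p -> supported L q -> supported L (p - q).
Proof. by move=> pL qL; apply/supportedD/supportedN. Qed.

Lemma supportedMn L p n : supported L p -> supported L (p *+ n).
Proof.
move=> pL i; rewrite coefMn => pi; apply: pL.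
by apply: contraNneq pi => ->; rewrite mul0rn.
Qed.

Lemma supported_euler L p : supported L p -> supported L (euler p).
Proof.
move=> pL i; rewrite coef_euler => pi; apply: pL.
by apply: contraNneq pi => ->; rewrite mul0rn.
Qed.

Lemma supportedM L S T p q : supported L p -> supported S q ->
  (forall i j, i \in L -> j \in S -> (i + j)%N \in T) -> supported T (p * q).
Proof.
move=> pL qS LST i; apply: contraNT => iT; rewrite coefM big1 // => j _.
have [->|pj] := eqVneq p`_j 0; first by rewrite mul0r.
have [->|qj] := eqVneq q`_(i - j) 0; first by rewrite mulr0.
have ji : (j <= i)%N by rewrite -ltnS.
by have := LST _ _ (pL _ pj) (qS _ qj); rewrite subnKC // (negbTE iT).
Qed.

Lemma supported_nsumsM S m n p q : supported (nsums S m) p ->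
  supported (nsums S n) q -> supported (nsums S (m + n)) (p * q).
Proof. by move=> pS qS; apply: supportedM pS qS _; apply: nsumsD. Qed.

Lemma supported1 S : supported (nsums S 0) (1 : {poly R}).
Proof.
by move=> i; rewrite coef1 nsums0 inE; case: (i == 0%N) => //; rewrite eqxx.
Qed.

Lemma supported_prod (I : Type) (L : I -> seq nat) (f : I -> {poly R})
    (r : seq I) :
  (forall j, supported (L j) (f j)) ->
  supported (sumset L r) (\prod_(j <- r) f j).
Proof.
move=> fL; elim: r => [|j r IHr].
  by rewrite big_nil; exact: (supported1 [::]).
rewrite big_cons; apply: supportedM (fL j) IHr _ => x y xL yS.
exact: allpairs_f.
Qed.

(* The polynomial [l] is [\prod_j f j] times the logarithmic derivative of
   [\prod_j f j ^+ a j]; its support does not depend on the exponents. *)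
Lemma euler_prod_exp (I : Type) (L : I -> seq nat) (f : I -> {poly R})
    (a : I -> nat) (r : seq I) : (forall j, supported (L j) (f j)) ->
  exists2 l, supported (sumset L r) l &
    (\prod_(j <- r) f j) * euler (\prod_(j <- r) f j ^+ a j) =
    (\prod_(j <- r) f j ^+ a j) * l.
Proof.
move=> fL; elim: r => [|j r [l lS lE]].
  exists 0; first by move=> i; rewrite coef0 eqxx.
  by rewrite !big_nil /euler derivC !mulr0.
(* Logarithmic derivatives add up; this is their sum cleared of denominators. *)
exists ((euler (f j) *+ a j) * \prod_(j <- r) f j + f j * l).
  have sub x y : x \in L j -> y \in sumset L r ->
      (x + y)%N \in sumset L (j :: r).
    by move=> xL yS; apply: allpairs_f.
  apply: supportedD.
    apply: supportedM _ (supported_prod fL) sub.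
    exact/supportedMn/supported_euler.
  exact: supportedM (fL j) lS sub.
rewrite !big_cons eulerM.
have fE : f j * euler (f j ^+ a j) = f j ^+ a j * (euler (f j) *+ a j).
  rewrite /euler deriv_exp; case: (a j) => [|n].
    by rewrite !mulr0n !mulr0.
  by rewrite /= exprS !mulrnAr; congr (_ *+ _); ring.
move: fE lE; set fa := f j ^+ a j; set Pf := \prod_(j <- r) f j.
set Fr := \prod_(j <- r) _ => fE lE.
transitivity (f j * euler fa * (Fr * Pf) + f j * fa * (Pf * euler Fr)).
  by ring.
by rewrite fE lE; ring.
Qed.

(** * The iterated Rolle argument *)

(** Iterating [n |-> 2n + 1] gives [2 ^ i * n.+1 - 1] at step [i]. A step pays twice for the zeros
    of the coefficient divided by, and [N] for those of [pi] together with Rolle's extra root. *)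
Definition rolle_bound N k n : nat :=
  \sum_(i < k) (2 * 'C((N + (2 ^ i * n.+1 - 1)).-1, 2 ^ i * n.+1 - 1) + N).

Lemma rolle_boundS N k n : rolle_bound N k.+1 n =
  (2 * 'C((N + n).-1, n) + N + rolle_bound N k (2 * n).+1)%N.
Proof.
rewrite /rolle_bound big_ord_recl expn0 mul1n subn1 /=; congr (_ + _)%N.
apply: eq_bigr => i _; rewrite /bump /= add1n expnS.
by have -> : (2 * 2 ^ i * n.+1 = 2 ^ i * (2 * n).+2)%N by lia.
Qed.

Lemma rolle_bound_leS N k n : (rolle_bound N k n <= rolle_bound N k.+1 n)%N.
Proof. by rewrite /rolle_bound big_ord_recr leq_addr. Qed.

Section SumCount.
Variables (I : Type) (S : seq nat) (N : nat).
Variables (pi : {poly R}) (F l : I -> {poly R}).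
Hypotheses (SN : (size S <= N)%N) (pi0 : pi != 0) (piS : supported S pi).
Hypotheses (lS : forall i, supported S (l i)).
Hypotheses (lE : forall i, pi * euler (F i) = F i * l i).
Hypotheses (Fpi : forall i x, root (F i) x -> root pi x).

Lemma size_nsums_le n : (size (nsums S n) <= 'C((N + n).-1, n))%N.
Proof.
rewrite size_nsums; apply: leq_bin2l.
by rewrite -!subn1 leq_sub2r // leq_add2r.
Qed.

(** Induction on the number of terms, for arbitrary coefficients [g]: a Rolle step changes the
    coefficients but keeps the [F i]. *)
Lemma nroots_sum (r : seq I) n (g : I -> {poly R}) :
    (forall i, supported (nsums S n) (g i)) ->
    \sum_(i <- r) g i * F i != 0 ->
  (nroots (pos_off pi) (\sum_(i <- r) g i * F i) <= rolle_bound N (size r) n)%N.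
Proof.
elim: r n g => [|i0 r IHr] n g gS; first by rewrite big_nil eqxx.
rewrite big_cons; have [->|g0] := eqVneq (g i0) 0.
  rewrite mul0r add0r => phi0.
  exact: leq_trans (IHr n g gS phi0) (rolle_bound_leS _ _ _).
set G := g i0 * F i0; set phi := G + _ => phi0.
have piS1 : supported (nsums S 1) pi by move=> i /piS/mem_nsums1.
have lS1 i : supported (nsums S 1) (l i) by move=> j /lS/mem_nsums1.
(* Chosen so that [pi * wronskian (g i * F i) G = F i0 * (h i * F i)]. Each product in it has one
   factor supported in [S] and two in [nsums S n]. *)
pose h i := pi * (euler (g i) * g i0 - g i * euler (g i0)) +
            g i * g i0 * (l i - l i0).
have hS i : supported (nsums S (2 * n).+1) (h i).
  have e1 : (2 * n).+1 = (1 + (n + n))%N by lia.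
  have e2 : (2 * n).+1 = (n + n + 1)%N by lia.
  apply: supportedD.
    rewrite e1; apply: supported_nsumsM => //.
    by apply: supportedB; apply: supported_nsumsM => //; apply: supported_euler.
  rewrite e2; apply: supported_nsumsM; first exact: supported_nsumsM.
  exact: supportedB.
pose psi := \sum_(i <- r) h i * F i.
have E : pi * wronskian phi G = F i0 * psi.
  rewrite /phi /psi; elim: r {IHr phi phi0 psi} => [|i r IHr].
    by rewrite !big_nil addr0 /wronskian; ring.
  rewrite !big_cons [RHS]mulrDr -IHr; set P := \sum_(i <- r) _.
  have -> : pi * wronskian (G + (g i * F i + P)) G =
      pi * wronskian (g i * F i) G + pi * wronskian (G + P) G.
    by rewrite /wronskian !eulerD; ring.
  congr (_ + _); rewrite /wronskian /G !eulerM.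
  transitivity (pi * (euler (g i) * g i0 - g i * euler (g i0)) * F i * F i0
     + g i * g i0 * F i0 * (pi * euler (F i))
     - g i * g i0 * F i * (pi * euler (F i0))).
    by ring.
  by rewrite !lE /h; ring.
rewrite [size _]/= rolle_boundS.
have ng := leq_trans (nroots_supported g0 (gS i0)) (size_nsums_le n).
have npi := leq_trans (nroots_supported pi0 piS) SN.
(* All zeros of [G] and [F i0] are zeros of [g i0 * pi], the exceptional polynomial for Rolle. *)
have d0 : g i0 * pi != 0 by rewrite mulf_neq0.
have Gd x : root G x -> root (g i0 * pi) x.
  by rewrite !rootM => /orP[->//|/Fpi->]; rewrite orbT.
have Fd x : root (F i0) x -> root (g i0 * pi) x.
  by rewrite rootM => /Fpi->; rewrite orbT.
(* If [psi] vanishes, the Wronskian does too, so roots of [phi] off [pi] are roots of [g i0]. *)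
have [psi0|psi0] := eqVneq psi 0.
  have W0 : wronskian phi G = 0.
    by apply/eqP; move/eqP: E; rewrite psi0 mulr0 mulf_eq0 (negbTE pi0).
  suff H : (nroots (pos_off pi) phi <= nroots positive (g i0))%N.
    by move: ng H; move: (nroots _ (g i0)) (nroots _ phi) => u v; lia.
  apply: nroots_le => // x /andP[x0 pix] phix; split=> //.
  have := wronskian0_root phi0 W0 x0 phix.
  by rewrite rootM => /orP[//|/Fpi]; rewrite (negbTE pix).
have H := nroots_wronskian phi0 d0 psi0 E Gd Fd.
(* The zeros of [g i0] are paid for here as possible roots of [phi], and in [H2] as points where
   Rolle may fail. *)
have H1 : (nroots (pos_off pi) phi <=
    nroots positive (g i0) + nroots (pos_off (g i0 * pi)) phi)%N.
  apply: nroots_le_add => // x /andP[x0 pix] phix.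
  rewrite /pos_off /= x0 rootM (negbTE pix) orbF phix andbT.
  by case: (root _ _).
have H2 : (nroots positive (g i0 * pi) <=
    nroots positive (g i0) + nroots positive pi)%N.
  by apply: nroots_le_add => // x ->; rewrite rootM.
have H3 : (nroots (pos_off (g i0 * pi)) psi <= nroots (pos_off pi) psi)%N.
  apply: nroots_le => // x /andP[x0].
  rewrite rootM negb_or => /andP[_ pix] psix.
  by split=> //; rewrite /pos_off /= x0.
have := IHr _ _ hS psi0.
move: ng npi H H1 H2 H3; rewrite -/psi.
move: (nroots (pos_off pi) phi) (nroots _ (g i0)) (nroots _ phi)
  (nroots _ pi) (nroots _ (g i0 * pi)) (nroots (pos_off pi) psi)
  (nroots _ psi) ('C(_, _)) (rolle_bound _ _ _) => *.
by lia.
Qed.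

End SumCount.

(** * From positive roots to all real roots *)

Lemma supported_comp_polyNX L p : supported L p -> supported L (p \Po (- 'X)).
Proof.
move=> pL i; apply: contraNT => iL; rewrite coef_comp_poly big1 // => j _.
rewrite exprNn -(polyCN 1) -polyC_exp coefCM coefXn.
case: eqP => [<-|_]; last by rewrite !mulr0.
by have [->|/pL] := eqVneq p`_i 0; rewrite ?mul0r // (negbTE iL).
Qed.

Lemma comp_polyNXK p : (p \Po (- 'X)) \Po (- 'X) = p.
Proof. by rewrite -comp_polyA raddfN /= comp_polyX opprK comp_polyXr. Qed.

Lemma sum_of_powers_comp (k m : nat) (f : 'I_m -> {poly R})
    (alpha : 'I_k -> 'I_m -> nat) q :
  sum_of_powers (fun j => f j \Po q) alpha = sum_of_powers f alpha \Po q.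
Proof.
rewrite /sum_of_powers raddf_sum; apply: eq_bigr => i _ /=.
by rewrite rmorph_prod; apply: eq_bigr => j _ /=; rewrite rmorphXn.
Qed.

Lemma size_index_ord n : size (index_enum 'I_n) = n.
Proof. by rewrite -sum1_size sum1_card card_ord. Qed.

(** The induction starts with all coefficients equal to 1 and [n = 0]; the final [t ^ m] restores
    roots that are zeros of [pi]. *)
Lemma nroots_sum_of_powers (k m t : nat) (f : 'I_m -> {poly R})
    (alpha : 'I_k -> 'I_m -> nat) (L : 'I_m -> seq nat) :
    (forall j, f j != 0) -> (forall j, (size (L j) <= t)%N) ->
    (forall j, supported (L j) (f j)) -> sum_of_powers f alpha != 0 ->
  (nroots positive (sum_of_powers f alpha) <=
     rolle_bound (t ^ m) k 0 + t ^ m)%N.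
Proof.
move=> f0 Lt fL phi0.
pose S := sumset L (index_enum 'I_m); pose pi := \prod_j f j.
pose F i := \prod_j f j ^+ alpha i j.
have SN : (size S <= t ^ m)%N.
  by have := size_sumset (index_enum 'I_m) Lt; rewrite size_index_ord.
have pi0 : pi != 0 by apply/prodf_neq0.
have piS : supported S pi by apply: supported_prod.
have /fin_all_exists2[l lS lE] : forall i, exists2 l, supported S l &
    pi * euler (F i) = F i * l by move=> i; apply: euler_prod_exp fL.
have Fpi i x : root (F i) x -> root pi x.
  rewrite /root !horner_prod => /prodf_eq0[j _]; rewrite horner_exp expf_eq0.
  by move=> /andP[_ fj]; apply/prodf_eq0; exists j.
have E : sum_of_powers f alpha = \sum_(i <- index_enum 'I_k) 1 * F i.
  by apply: eq_bigr => i _; rewrite mul1r.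
have := @nroots_sum _ _ _ _ F l SN pi0 piS lS lE Fpi (index_enum 'I_k) 0
  (fun=> 1) (fun=> supported1 _).
rewrite -E size_index_ord => /(_ phi0) H.
have npi := nroots_supported pi0 piS.
have: (nroots positive (sum_of_powers f alpha) <=
    nroots (pos_off pi) (sum_of_powers f alpha) + nroots positive pi)%N.
  apply: nroots_le_add => // x x0 ->.
  by rewrite /pos_off /= x0; case: (root pi x).
move/leq_trans; apply; apply: leq_add => //.
by apply: leq_trans SN; apply: ltnW.
Qed.

Lemma size_sign_split (s : seq R) : uniq s ->
  (size s <= count [pred x | (0 < x)%R] s + count [pred x | (x < 0)%R] s + 1)%N.
Proof.
move=> us; have := leq_b1 (0%R \in s); rewrite -count_uniq_mem //.
set c := count_mem _ _ => c1.
suff -> : size s =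
    (count [pred x | (0 < x)%R] s + count [pred x | (x < 0)%R] s + c)%N.
  by rewrite leq_add2l.
rewrite /c {us c c1}; elim: s => //= x s ->.
by case: (ltgtP x 0); lia.
Qed.

(** The factor 2 accounts for the two signs, the final 1 for the root 0. Since ['X |-> - 'X]
    preserves supports, the same lists [L] serve both half-lines. *)
Lemma size_roots_sum_of_powers (k m t : nat) (f : 'I_m -> {poly R})
    (alpha : 'I_k -> 'I_m -> nat) (s : seq R) :
    (forall j, f j != 0) -> (forall j, sparse t (f j)) ->
    sum_of_powers f alpha != 0 ->
    uniq s -> all (root (sum_of_powers f alpha)) s ->
  (size s <= 2 * (rolle_bound (t ^ m) k 0 + t ^ m) + 1)%N.
Proof.
move=> f0 ft phi0 us /allP rs; set B := (_ + t ^ m)%N.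
pose L j := [seq i <- iota 0 (size (f j)) | (f j)`_i != 0].
have Lt j : (size (L j) <= t)%N.
  have := ft j; rewrite /sparse size_filter; congr (_ <= _)%N.
  by rewrite -[in LHS](mkseq_nth 0 (f j)) /mkseq count_map.
have fL j : supported (L j) (f j).
  move=> i fi; rewrite mem_filter fi mem_iota /= add0n ltnNge.
  by apply: contra fi => /(nth_default 0)->.
have Hp := nroots_sum_of_powers f0 Lt fL phi0.
have f0' j : f j \Po (- 'X) != 0.
  by apply: contraNneq (f0 j) => E; rewrite -[f j]comp_polyNXK E comp_poly0.
have phi0' : sum_of_powers f alpha \Po (- 'X) != 0.
  apply: contraNneq phi0 => E.
  by rewrite -[sum_of_powers _ _]comp_polyNXK E comp_poly0.
have Hn := @nroots_sum_of_powers k m t _ alpha L f0' Lt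
   (fun j => supported_comp_polyNX (fL j)).
rewrite sum_of_powers_comp in Hn; have {}Hn := Hn phi0'.
apply: leq_trans (size_sign_split us) _; rewrite leq_add2r mul2n -addnn.
apply: leq_add; rewrite -size_filter.
  apply: leq_trans Hp; apply: size_le_nroots => //; first exact: filter_uniq.
  by move=> x; rewrite mem_filter => /andP[x0 /rs->]; rewrite andbT.
rewrite -(size_map -%R); apply: leq_trans Hn; apply: size_le_nroots => //.
  by rewrite (map_inj_uniq oppr_inj) filter_uniq.
move=> _ /mapP[x + ->]; rewrite mem_filter => /andP[/= x0 /rs/rootP rx].
rewrite /positive /= oppr_gt0 x0 /=; apply/rootP.
by rewrite horner_comp !hornerE opprK.
Qed.

(** * Numerical estimates *)

(** The constant is [11 = 4 + 6 + 1]: four for the binomial sum, six for the terms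
    [2 * k * N + 4 * N] (with [k] already lowered by one), one for the final 1. *)
Lemma rolle_bound_le_bin N k : (2 <= k)%N ->
  (2 * (rolle_bound N k 0 + N) + 1 <=
     11 * 'C(N + (2 ^ (k - 1) - 1), 2 ^ (k - 1) - 1))%N.
Proof.
case: k => // k k1; rewrite subSS subn0.
have -> : rolle_bound N k.+1 0 =
    (2 * \sum_(i < k.+1) 'C((N + (2 ^ i - 1)).-1, 2 ^ i - 1) + k.+1 * N)%N.
  rewrite /rolle_bound big_split /= sum_nat_const card_ord big_distrr /=.
  by congr (_ + _)%N; apply: eq_bigr => i _; rewrite muln1.
have H1 := sum_multichoose_dyadic N k; have H2 := muln_lt_bin N (2 ^ k - 1).
have H3 := ltn_expl k (isT : 1 < 2)%N.
have H4 : (k * N <= (2 ^ k - 1) * N)%N by rewrite leq_mul2r; lia.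
have H5 : (N <= (2 ^ k - 1) * N)%N by rewrite leq_pmull //; lia.
rewrite [(k.+1 * N)%N]mulSn; move: H1 H2 H4 H5.
move: (\sum_(i < _) _)%N 'C(_, _) (k * N)%N (_ * N)%N => A B C D.
by lia.
Qed.

(** The binomial is at most [(N + n) ^ n / n!], and [n ^ n / n!] is a single term of the series of
    [expR n]. *)
Lemma bin_le_expR N n : (0 < n)%N ->
  ('C(N + n, n))%:R <= (expR 1 * (1 + N%:R / n%:R)) ^+ n :> R.
Proof.
case: n => // n _; set m := n.+1.
have m0 : m%:R != 0 :> R by rewrite pnatr_eq0.
have f0 : 0 < m`!%:R :> R by rewrite ltr0n fact_gt0.
have -> : (1 + N%:R / m%:R) = (N + m)%:R / m%:R :> R.
  by rewrite natrD; field.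
rewrite exprMn -expRM_natl mulr1 exprMn exprVn.
have e : m%:R ^+ m / m`!%:R <= expR m%:R :> R.
  by apply: le_trans (expR_ge1Dxn n (ler0n _ _)); rewrite lerDr.
apply: le_trans (ler_wpM2r _ e); last by rewrite divr_ge0 // exprn_ge0.
have -> : m%:R ^+ m / m`!%:R * ((N + m)%:R ^+ m / m%:R ^+ m) =
    (N + m)%:R ^+ m / m`!%:R :> R.
  have := expf_neq0 m m0; have := lt0r_neq0 f0.
  move: ((m%:R : R) ^+ m) (m`!%:R : R) => x y y0 x0.
  by field; rewrite x0 y0.
rewrite ler_pdivlMr // -natrM bin_ffact -natrX ler_nat.
exact: ffact_leq_exp.
Qed.

End RealRoots.

Theorem theorem2 (R : realType) :
  exists C : R,
    forall (k m t : nat) (f : 'I_m -> {poly R}) (alpha : 'I_k -> 'I_m -> nat),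
      (2 <= k)%N -> (1 <= m)%N -> (1 <= t)%N ->
      (forall j : 'I_m, f j != 0) ->
      (forall j : 'I_m, sparse t (f j)) ->
      sum_of_powers f alpha != 0 ->
      forall s : seq R, uniq s -> all (root (sum_of_powers f alpha)) s ->
        (size s)%:R <=
          C * (expR 1 * (1 + (t ^ m)%N%:R / (2 ^ (k - 1) - 1)%N%:R))
                ^+ (2 ^ (k - 1) - 1)%N.
Proof.
exists 11%:R => k m t f alpha k2 _ _ f0 ft phi0 s us rs.
have H := leq_trans (size_roots_sum_of_powers f0 ft phi0 us rs)
  (rolle_bound_le_bin (t ^ m) k2).
rewrite -(ler_nat R) in H; apply: le_trans H _.
rewrite natrM ler_wpM2l //; apply: bin_le_expR.
by rewrite subn_gt0 -[X in (X < _)%N](expn0 2) ltn_exp2l // subn_gt0.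
Qed.
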